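(* Let $s,k$ be positive integers. Then: (a) Let $d\ge 3$, and let $G$ be an $n$-vertex $d$-regular graph containing $4s-2$ edges that are pairwise at distance at least $2k+2$. Then \[ (d+2\sqrt{d-1})\lambda_{s+1}(G)\le(d-2\sqrt{d-1})\lambda_{n-s+1}(G)+\frac{4(d-1)^{3/2}}{k+1}. \] (b) Let $d\ge 5$, and let $G$ be an $n$-vertex $d$-regular graph containing $2s+1$ vertices whose pairwise distances are all at least $4k$. Then \[ (\sqrt{d-1}+2)\mu_{s+1}(G)-(\sqrt{d-1}-2)\mu_{n-s+1}(G)\ge 4(d-1)\cos\left(\frac{\pi}{2k}\right). \]
   Context: All graphs are finite and simple. For a graph $G$ on $n$ vertices, $A_G$ is its adjacency matrix with eigenvalues $\mu_1(G)\ge\mu_2(G)\ge\cdots\ge\mu_n(G)$, and $L_G=D_G-A_G$ its Laplacian matrix ($D_G$ the diagonal degree matrix) with eigenvalues $0=\lambda_1(G)\le\cdots\le\lambda_n(G)$ (all with multiplicity). $\operatorname{dist}_G(u,v)$ is the length of a shortest $u$–$v$ path ($\infty$ if none exists). The distance between edges $e=xy$ and $f=uv$ is $\min\{\operatorname{dist}_G(x,u),\operatorname{dist}_G(x,v),\operatorname{dist}_G(y,u),\operatorname{dist}_G(y,v)\}$. *)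

(* Defs.v *)
From HB Require Import structures.
From mathcomp Require Import all_boot all_order all_algebra.
From mathcomp Require Import all_classical all_reals all_analysis.
From mathcomp Require Import spectral polyrcf complex.

Set Implicit Arguments.
Unset Strict Implicit.
Unset Printing Implicit Defensive.

Import Order.TTheory GRing.Theory Num.Theory.

Local Open Scope ring_scope.

Record simple_graph (T : finType) := SimpleGraph {
  adj :> rel T;
  adj_sym : symmetric adj;
  adj_irrefl : irreflexive adj
}.

Section Spectrum.
Variable R : rcfType.

(* Nondecreasing and with algebraic multiplicity. Only the roots in [R] occur,
   which for a real symmetric matrix are all of them: see [char_poly_spectrum]
   and [size_spectrum]. *)
Definition spectrum n (A : 'M[R]_n) : seq R :=
  flatten [seq nseq (mup x (char_poly A)) x | x <- rootsR (char_poly A)].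

Lemma spectrum_sorted n (A : 'M[R]_n) : sorted <=%R (spectrum A).
Proof.
rewrite /spectrum.
have: sorted <%R (rootsR (char_poly A)) by exact: sorted_roots.
rewrite !sorted_pairwise; [|exact: le_trans|exact: lt_trans].
elim: (rootsR _) => //= x s IH /andP[/allP xs /IH {}IH].
rewrite pairwise_cat IH andbT; apply/andP; split.
  apply/allrelP => a b /nseqP[-> _] /flatten_mapP[c cs /nseqP[-> _]].
  exact/ltW/xs.
by elim: (mup _ _) => //= m ->; rewrite andbT; apply/allP => y /nseqP[->].
Qed.

Lemma char_poly_conj (F : fieldType) n (P A B : 'M[F]_n) :
  P \in unitmx -> P *m A = B *m P -> char_poly A = char_poly B.
Proof.
move=> uP PAB; pose Q := map_mx (@polyC F) P.
have QN0 : \det Q != 0.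
  by rewrite /Q det_map_mx polyC_eq0 -unitfE -unitmxE.
apply: (mulfI QN0); rewrite /char_poly -det_mulmx mulrC -det_mulmx.
congr (\det _); rewrite /char_poly_mx mulmxBr mulmxBl -!map_mxM PAB.
by rewrite -scalar_mxC.
Qed.

Lemma symmetric_char_poly_split n (A : 'M[R]_n) : A^T = A ->
  exists s : seq R, char_poly A = \prod_(x <- s) ('X - x%:P).
Proof.
move=> symA; pose C : numClosedFieldType := complex R.
pose f : {rmorphism R -> C} := real_complex R.
pose B : 'M[C]_n := map_mx f A.
have hB : B \is hermsymmx.
  apply: realsym_hermsym.
    by apply/is_hermitianmxP; rewrite expr0 scale1r map_mx_id // map_trmx symA.
  by apply/mxOverP => i j; rewrite mxE complex_real.
have /orthomx_spectralP eB := hermitian_normalmx hB.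
have /mxOverP dR := hermitian_spectral_diag_real hB.
have uP : spectralmx B \in unitmx by exact: spectral_unit.
exists [seq complex.Re (spectral_diag B 0 i) | i <- enum 'I_n].
apply: (map_poly_inj f); rewrite map_char_poly -/B.
rewrite (@char_poly_conj _ _ (spectralmx B) _ (diag_mx (spectral_diag B))) //.
  rewrite char_poly_trig ?diag_mx_is_trig // rmorph_prod big_map big_enum.
  apply: eq_bigr => i _; rewrite rmorphB /= map_polyX map_polyC /=.
  by rewrite RRe_real ?dR // mxE eqxx mulr1n.
by rewrite [X in _ *m X]eB !mulmxA mulmxV // mul1mx.
Qed.

Lemma char_poly_spectrum n (A : 'M[R]_n) : A^T = A ->
  char_poly A = \prod_(x <- spectrum A) ('X - x%:P).
Proof.
move=> /symmetric_char_poly_split[s eA]; rewrite {1}eA.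
have pN0 : char_poly A != 0 by rewrite monic_neq0 ?char_poly_monic.
apply: perm_big; apply/allP => y _ /=; apply/eqP; rewrite /= /spectrum.
have -> : count_mem y s = mup y (char_poly A) by rewrite eA mu_prod_XsubC.
have uR : uniq (rootsR (char_poly A)) by exact: uniq_roots.
have rR : y \in rootsR (char_poly A) = root (char_poly A) y.
  by have := roots_on_rootsR pN0 y; rewrite in_itv.
rewrite count_flatten -map_comp sumnE big_map.
have [ry|nry] := boolP (root (char_poly A) y); last first.
  rewrite mupNroot // big_seq big1 // => x; rewrite -rR in nry.
  move=> xs; rewrite /= count_nseq /=; case: eqVneq => // xy.
  by rewrite -xy xs in nry.
rewrite (bigD1_seq y) ?rR //= count_nseq /= eqxx mul1n big1 ?addn0 // => x xy.
by rewrite count_nseq /= (negPf xy).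
Qed.

Lemma size_spectrum n (A : 'M[R]_n) : A^T = A -> size (spectrum A) = n.
Proof.
move=> /char_poly_spectrum /(congr1 (fun p : {poly R} => size p)).
by rewrite size_char_poly size_prod_XsubC => -[].
Qed.
End Spectrum.

Section Graph.
Variables (R : realType) (T : finType) (G : simple_graph T).

Definition degree (x : T) : nat := #|[set y | G x y]|.

Definition regular (d : nat) : Prop := forall x, degree x = d.

Definition adjacency_mx : 'M[R]_#|T| :=
  \matrix_(i, j) (G (enum_val i) (enum_val j))%:R.

Definition degree_mx : 'M[R]_#|T| :=
  diag_mx (\row_i (degree (enum_val i))%:R).

Definition laplacian_mx : 'M[R]_#|T| := degree_mx - adjacency_mx.

(* Eigenvalues are numbered from 1: [mu 1] is the largest eigenvalue of the
   adjacency matrix, [lambda 1] the smallest eigenvalue of the Laplacian. *)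
Definition mu (i : nat) : R := nth 0 (rev (spectrum adjacency_mx)) i.-1.

Definition lambda (i : nat) : R := nth 0 (spectrum laplacian_mx) i.-1.

(* The infimum of the empty set is [+oo]. *)
Definition dist (u v : T) : \bar R :=
  ereal_inf [set (size p)%:R%:E | p in
    [set p : seq T | [/\ path G u p, uniq (u :: p) & last u p = v]]]%classic.

Definition edges : {set {set T}} := [set [set p.1; p.2] | p : T * T & G p.1 p.2].

Definition edge_dist (e f : {set T}) : \bar R :=
  \big[Order.min/+oo%E]_(x in e) \big[Order.min/+oo%E]_(u in f) dist x u.

Lemma adjacency_mx_sym : adjacency_mx^T = adjacency_mx.
Proof. by apply/matrixP => i j; rewrite !mxE adj_sym. Qed.

Lemma laplacian_mx_sym : laplacian_mx^T = laplacian_mx.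
Proof. by rewrite linearB /= adjacency_mx_sym tr_diag_mx. Qed.

Lemma edge_dist_pair (x y u v : T) : edge_dist [set x; y] [set u; v] =
  Order.min (Order.min (dist x u) (dist x v)) (Order.min (dist y u) (dist y v)).
Proof.
have big2 (a b : T) (F : T -> \bar R) :
    \big[Order.min/+oo%E]_(z in [set a; b]) F z = Order.min (F a) (F b).
  apply/le_anti/andP; split.
    by rewrite le_min !bigmin_le_cond ?set21 ?set22.
  apply/bigmin_geP; split; first by rewrite leey.
  by move=> z /set2P[] ->; rewrite ge_min lexx ?orbT.
by rewrite /edge_dist big2 !big2.
Qed.

End Graph.

Arguments mu R {T} G i.
Arguments lambda R {T} G i.
Arguments dist R {T} G u v.
Arguments edge_dist R {T} G e f.

(* Main.v *)
(** The Courant-Fischer principle, applied to many test functions with disjoint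
    and nonadjacent supports, one around each of the given edges (or vertices):
    if U indexes pairs f_v, g_v of equal norm with
      alpha <f_v, A f_v> <= beta <g_v, A g_v> + c |f_v|^2
    then fewer than |U| of the v can be lost to the lowest and the highest
    eigenvalues together, so one v compares the eigenvalue number i from the
    bottom with the eigenvalue number j from the top.
    Put r = sqrt (d - 1) and let l be the distance to the edge or vertex v.
    (a) f = r^-l for l <= k, and g = (-1)^l f.  An edge between the levels l and
    l + 1 <= k contributes r^-2l (1 -+ 1/r)^2 to the Laplacian forms, so the
    weights (r + 1)^2 = d + 2r and (r - 1)^2 = d - 2r cancel all but the edges
    that leave the level k, which carries at most 1/(k + 1) of the norm.
    (b) g = r^-l sin (pi l / 2k), which on a tree satisfies
    A g = 2 r cos (pi / 2k) g, and f = (-1)^l g.  The weighted difference of the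
    adjacency forms counts an edge inside a level 4 times and an edge between
    levels 2r times, and then a tree neighbourhood is the worst case. *)
Require Import Defs.
From mathcomp Require Import all_boot all_order all_algebra.
From mathcomp Require Import all_classical all_reals all_analysis.
From mathcomp Require Import complex.
From mathcomp Require Import ring lra zify.

Import Order.TTheory GRing.Theory Num.Theory.
Local Open Scope ring_scope.

Set Implicit Arguments.
Unset Strict Implicit.
Unset Printing Implicit Defensive.

(** * Diagonalization and the dimension count *)

Section TestVectors.
Local Open Scope sesquilinear_scope.
Variable R : rcfType.
Let C : numClosedFieldType := complex R.
Let f : {rmorphism R -> C} := real_complex R.

(** Over the complexification a real symmetric matrix is Hermitian, hence unitarily diagonalizable
    with a real diagonal. The common characteristic polynomial matches that diagonal with
    [spectrum A] up to order. *)
Lemma symmetric_diagonalization n (A : 'M[R]_n) : A^T = A ->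
  exists (P : 'M[C]_n) (d : 'rV[R]_n),
    [/\ P \is unitarymx, map_mx f A = P ^t* *m diag_mx (map_mx f d) *m P &
        perm_eq [seq d 0 i | i <- enum 'I_n] (spectrum A)].
Proof.
move=> symA; pose B := map_mx f A.
have hB : B \is hermsymmx.
  apply: realsym_hermsym.
    by apply/is_hermitianmxP; rewrite expr0 scale1r map_mx_id // map_trmx symA.
  by apply/mxOverP => i j; rewrite mxE complex_real.
have /orthomx_spectralP eB := hermitian_normalmx hB.
have /mxOverP dR := hermitian_spectral_diag_real hB.
have uP := spectral_unitarymx B.
pose d : 'rV[R]_n := \row_i complex.Re (spectral_diag B 0 i).
have dE : map_mx f d = spectral_diag B.
  by apply/rowP => i; rewrite !mxE /f /= RRe_real ?dR.
exists (spectralmx B), d; split => //.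
  by rewrite dE -/B {1}eB invmx_unitary.
have eA : char_poly A = \prod_(x <- [seq d 0 i | i <- enum 'I_n]) ('X - x%:P).
  apply: (map_poly_inj f); rewrite map_char_poly -/B.
  rewrite (@char_poly_conj _ _ (spectralmx B) _ (diag_mx (map_mx f d))).
  - rewrite char_poly_trig ?diag_mx_is_trig // rmorph_prod big_map big_enum.
    apply: eq_bigr => i _; rewrite rmorphB /= map_polyX map_polyC /=.
    by rewrite !mxE eqxx mulr1n.
  - exact: spectral_unit.
  - by rewrite dE [X in _ *m X]eB !mulmxA mulmxV ?mul1mx ?spectral_unit.
apply/allP => y _ /=; apply/eqP.
by rewrite -!mu_prod_XsubC -char_poly_spectrum // eA.
Qed.

Lemma row_mul_diag n (y : 'rV[C]_n) (D : 'M[C]_n) :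
  (forall i j, i != j -> D i j = 0) ->
  (y *m D *m y ^t*) 0 0 = \sum_i D i i * `|y 0 i| ^+ 2.
Proof.
move=> D0; rewrite mxE; apply: eq_bigr => i _; rewrite !mxE.
rewrite (bigD1 i) //= big1 ?addr0; last by move=> j /D0 ->; rewrite mulr0.
by rewrite normCK mulrAC mulrC.
Qed.

(* Courant-Fischer by dimension count: if too few eigenvalues satisfied the
   inequality, some combination of the rows of [F] would be orthogonal to all
   their eigenvectors. *)
Lemma count_spectrum m n (A : 'M[R]_n) (F : 'M[R]_(m, n)) (e t : R) :
  A^T = A ->
  (forall i j, i != j -> (F *m (e *: (A - t%:M)) *m F^T) i j = 0) ->
  (forall i, (F *m (e *: (A - t%:M)) *m F^T) i i < 0) ->
  (m <= count (fun x => (e * (x - t) < 0)%R) (spectrum A))%N.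
Proof.
move=> /symmetric_diagonalization[P [d [uP eA sA]]].
set B := F *m _ *m _ => B0 Bneg; rewrite leqNgt; apply/negP => ltm.
pose J := [set i | e * (d 0 i - t) < 0].
have cJ : #|J| = count (fun x => e * (x - t) < 0) (spectrum A).
  rewrite -(permP sA) count_map cardE /enum_mem size_filter count_filter.
  by apply: eq_count => i; rewrite /= !inE andbT.
rewrite -cJ in ltm.
(* [Q] holds the eigenbasis coordinates in [J] of the rows of [F]. It has more rows than columns, so
   some nonzero [c] annihilates it. *)
pose Q : 'M[C]_(m, #|J|) := colsub enum_val (map_mx f F *m P ^t*).
have /rowV0Pn[c cQ cN0] : kermx Q != 0.
  rewrite kermx_eq0 /row_free neq_ltn; apply/orP; left.
  by rewrite (leq_ltn_trans (rank_leq_col _)).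
have {}cQ := sub_kermxP cQ.
pose y := c *m map_mx f F *m P ^t*.
have yJ i : i \in J -> y 0 i = 0.
  move=> iJ; have := congr1 (fun M : 'rV_#|J| => M 0 (enum_rank_in iJ i)) cQ.
  rewrite [in RHS]mxE => <-; rewrite /y -mulmxA [LHS]mxE [RHS]mxE.
  by apply: eq_bigr => j _; rewrite [Q _ _]mxE enum_rankK_in.
have PtP : P ^t* *m P = 1%:M by rewrite -invmx_unitary // mulVmx ?unitarymx_unit.
pose D : 'M[C]_n := f e *: (diag_mx (map_mx f d) - (f t)%:M).
have E : c *m map_mx f B *m c ^t* = y *m D *m y ^t*.
  have -> : map_mx f B = map_mx f F *m P ^t* *m D *m (map_mx f F *m P ^t*) ^t*.
    rewrite /B !map_mxM map_mxZ map_mxB map_scalar_mx eA.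
    have FT : (map_mx f F) ^t* = map_mx f F^T.
      by apply/matrixP => i j; rewrite !mxE; exact: conjc_real.
    have -> : (map_mx f F *m P ^t*) ^t* = P *m map_mx f F^T.
      by rewrite trmx_mul map_mxM trmxCK FT.
    rewrite /D -!mulmxA; congr (_ *m _); rewrite !mulmxA; congr (_ *m _).
    rewrite -!scalemxAr -!scalemxAl; congr (_ *: _).
    by rewrite mulmxBr mulmxBl mul_mx_scalar -scalemxAl PtP scalemx1.
  have -> : y = c *m (map_mx f F *m P ^t*) by rewrite mulmxA.
  move: (map_mx f F *m P ^t*) => H.
  by rewrite trmx_mul map_mxM !mulmxA.
have := congr1 (fun M : 'M[C]_1 => M 0 0) E.
rewrite !row_mul_diag; first last.
- by move=> i j ij; rewrite mxE B0 // rmorph0.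
- by move=> i j ij; rewrite !mxE (negPf ij) !mulr0n subr0 mulr0.
(* The two sides of the identity have opposite signs: on the right the coordinates in [J] vanish and
   the other coefficients are nonnegative; on the left a nonzero [c] meets a negative diagonal. *)
have Rge : 0 <= \sum_i D i i * `|y 0 i| ^+ 2.
  apply: sumr_ge0 => i _; have [/yJ->|] := boolP (i \in J).
    by rewrite normr0 expr0n mulr0.
  rewrite inE -leNgt => le0; rewrite mulr_ge0 ?exprn_ge0 //.
  by rewrite !mxE eqxx !mulr1n -rmorphB -rmorphM /= lecR.
have [i ciN0] : exists i, c 0 i != 0 by exact/rV0Pn.
move=> EE; move: Rge; rewrite -EE; apply/negP; rewrite lt_geF //.
have le0 j : map_mx f B j j * `|c 0 j| ^+ 2 <= 0.
  by rewrite mulr_le0_ge0 ?exprn_ge0 // mxE lecR ltW.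
rewrite (bigD1 i) //= ltr_nwDl // ?sumr_le0 //.
by rewrite nmulr_rlt0 ?exprn_gt0 ?normr_gt0 // mxE ltcR.
Qed.

End TestVectors.

(** * From counts to individual eigenvalues *)

Section Spectrum.
Variable R : rcfType.

(** If entry [i] were at least [t], so would be all later ones, leaving at most [i] entries below
    [t]. *)
Lemma sorted_count_lt (s : seq R) (t : R) i : sorted <=%R s ->
  (i < count (fun x => (x < t)%R) s)%N -> nth 0 s i < t.
Proof.
move=> ss ic; rewrite ltNge; apply/negP => ti; move: ic; apply/negP.
rewrite -leqNgt -{1}(cat_take_drop i s) count_cat.
have -> : count (fun x => (x < t)%R) (drop i s) = 0%N.
  apply/eqP; rewrite -leqn0 leqNgt -has_count; apply/hasPn => x.
  move=> /(nthP 0)[j]; rewrite size_drop nth_drop ltn_subRL => jlt <-.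
  rewrite -leNgt (le_trans ti) //.
  apply: (sorted_leq_nth le_trans lexx) => //; rewrite ?inE ?leq_addr //.
  exact: leq_ltn_trans (leq_addr _ _) jlt.
by rewrite addn0 (leq_trans (count_size _ _)) // size_take_min geq_minl.
Qed.

Lemma sorted_count_gt (s : seq R) (t : R) i : sorted <=%R s ->
  (i < count (fun x => (t < x)%R) s)%N -> t < nth 0 s (size s - i.+1).
Proof.
move=> ss ic; have si := leq_trans ic (count_size _ _).
have := @sorted_count_lt [seq - x | x <- rev s] (- t) i.
rewrite (nth_map 0) ?size_rev // nth_rev // ltrN2; apply.
  rewrite sorted_map rev_sorted.
  by apply: sub_sorted ss => x y /=; rewrite lerN2.
rewrite count_map count_rev; congr (_ < _)%N: ic; apply: eq_count => x.
by rewrite /= ltrN2.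
Qed.

Definition mxform n (A : 'M[R]_n) (u v : 'rV[R]_n) : R := (u *m A *m v^T) 0 0.

(** The sign [e] selects the side: 1 counts eigenvalues below [t], -1 those above. *)
Lemma count_spectrum_family n (A : 'M[R]_n) (I : finType) (U : {set I})
    (phi : I -> 'rV[R]_n) (e t : R) : A^T = A ->
  {in U &, forall v w, v != w ->
    mxform A (phi v) (phi w) = 0 /\ mxform 1%:M (phi v) (phi w) = 0} ->
  {in U, forall v,
    e * (mxform A (phi v) (phi v) - t * mxform 1%:M (phi v) (phi v)) < 0} ->
  (#|U| <= count (fun x => (e * (x - t) < 0)%R) (spectrum A))%N.
Proof.
move=> symA phi0 phineg.
pose F : 'M[R]_(#|U|, n) := \matrix_i phi (enum_val i).
have FE i j : (F *m (e *: (A - t%:M)) *m F^T) i j =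
    e * (mxform A (phi (enum_val i)) (phi (enum_val j))
         - t * mxform 1%:M (phi (enum_val i)) (phi (enum_val j))).
  have -> M : (F *m M *m F^T) i j =
      mxform M (phi (enum_val i)) (phi (enum_val j)).
    have -> : F^T = \matrix_(k, l) phi (enum_val l) 0 k.
      by apply/matrixP => k l; rewrite !mxE.
    rewrite /mxform !mxE; apply: eq_bigr => k _; rewrite !mxE; congr (_ * _).
    by apply: eq_bigr => l _; rewrite !mxE.
  rewrite /mxform -scalemxAr -scalemxAl mulmxBr mulmxBl -[t%:M]scalemx1.
  by rewrite -scalemxAr -scalemxAl !mxE.
apply: (count_spectrum (F := F)) => // [i j ij|i]; rewrite FE.
  have [] := phi0 _ _ (enum_valP i) (enum_valP j).
    by apply: contra_neq ij => /enum_val_inj.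
  by move=> -> ->; rewrite mulr0 subrr mulr0.
exact/phineg/enum_valP.
Qed.

Lemma spectrum_tradeoff n (A : 'M[R]_n) (I : finType) (U : {set I})
    (f g : I -> 'rV[R]_n) (a b c : R) i j : A^T = A -> 0 <= a -> 0 <= b ->
  (i + j < #|U|)%N ->
  {in U, forall v, 0 < mxform 1%:M (f v) (f v)} ->
  {in U, forall v, mxform 1%:M (g v) (g v) = mxform 1%:M (f v) (f v)} ->
  {in U &, forall v w, v != w ->
    mxform A (f v) (f w) = 0 /\ mxform 1%:M (f v) (f w) = 0} ->
  {in U &, forall v w, v != w ->
    mxform A (g v) (g w) = 0 /\ mxform 1%:M (g v) (g w) = 0} ->
  {in U, forall v, a * mxform A (f v) (f v) <=
    b * mxform A (g v) (g v) + c * mxform 1%:M (f v) (f v)} ->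
  a * (spectrum A)`_i <= b * (spectrum A)`_(n - j.+1) + c.
Proof.
move=> symA a0 b0 ijU N0 gf f0 g0 le_fg; rewrite leNgt; apply/negP => lt_c.
set t := _`_i in lt_c; set u := _`_(_ - _) in lt_c.
(* [U1] and [U2] collect the indices lost to the low and to the high end, comparing Rayleigh
   quotients with [t] and [u]. *)
pose U1 := [set v in U | mxform A (f v) (f v) < t * mxform 1%:M (f v) (f v)].
pose U2 := [set v in U | u * mxform 1%:M (g v) (g v) < mxform A (g v) (g v)].
have subU (V : {set I}) (h : I -> 'rV[R]_n) : V \subset U ->
    {in U &, forall v w, v != w ->
      mxform A (h v) (h w) = 0 /\ mxform 1%:M (h v) (h w) = 0} ->
    {in V &, forall v w, v != w ->
      mxform A (h v) (h w) = 0 /\ mxform 1%:M (h v) (h w) = 0}.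
  by move=> /fintype.subsetP VU h0 v w vV wV; apply: h0; exact: VU.
(* More than [i] members would force more than [i] eigenvalues strictly below [t], yet [t] is entry
   [i], counted from 0. *)
have le1 : (#|U1| <= i)%N.
  rewrite leqNgt; apply/negP => lt1.
  suff: t < t by rewrite ltxx.
  apply: sorted_count_lt; first exact: spectrum_sorted.
  apply: (leq_trans lt1); apply: (leq_trans (count_spectrum_family
    (e := 1) (t := t) symA (subU _ _ _ f0) _)).
  - by apply/fintype.subsetP => v; rewrite inE => /andP[].
  - by move=> v; rewrite inE => /andP[_]; rewrite mul1r subr_lt0.
  - by rewrite (eq_count (a2 := fun x => (x < t)%R)) // => x; rewrite mul1r subr_lt0.
have le2 : (#|U2| <= j)%N.
  rewrite leqNgt; apply/negP => lt2.
  suff: u < u by rewrite ltxx.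
  rewrite {2}/u -[X in (X - _)%N](size_spectrum symA).
  apply: sorted_count_gt; first exact: spectrum_sorted.
  apply: (leq_trans lt2); apply: (leq_trans (count_spectrum_family
    (e := -1) (t := u) symA (subU _ _ _ g0) _)).
  - by apply/fintype.subsetP => v; rewrite inE => /andP[].
  - by move=> v; rewrite inE => /andP[_]; rewrite mulN1r oppr_lt0 subr_gt0.
  - by rewrite (eq_count (a2 := fun x => (u < x)%R)) // => x;
      rewrite mulN1r oppr_lt0 subr_gt0.
(* An index outside both sets would give [a t N <= (b u + c) N] with [N > 0], against [lt_c]. *)
have : U \subset U1 :|: U2.
  apply/fintype.subsetP => v vU; rewrite !inE vU /=.
  case: (ltP (mxform A (f v) (f v))) => //= ge_f.
  rewrite ltNge; apply/negP => le_g.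
  have := le_trans (ler_wpM2l a0 ge_f) (le_fg v vU).
  rewrite gf // in le_g.
  have := ler_wpM2l b0 le_g; have := N0 v vU.
  set N := mxform 1%:M _ _ => N_gt0 h1 h2.
  have : (b * u + c) * N < a * t * N by rewrite ltr_pM2r.
  by lra.
move=> /subset_leq_card; apply/negP; rewrite -ltnNge.
apply: leq_ltn_trans ijU; rewrite (leq_trans (leq_card_setU _ _)) //.
exact: leq_add.
Qed.

End Spectrum.

(** * Quadratic forms as sums over vertices and edges *)

Section Forms.
Variables (R : realType) (T : finType) (G : simple_graph T).
Implicit Types h : T -> R.

Definition rowfun h : 'rV[R]_#|T| := \row_i h (enum_val i).

Lemma mxform_sum (M : 'M[R]_#|T|) (m : T -> T -> R) h h' :
  (forall i j, M i j = m (enum_val i) (enum_val j)) ->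
  mxform M (rowfun h) (rowfun h') = \sum_x \sum_y h x * m x y * h' y.
Proof.
move=> ME; have sumE (F : T -> R) : \sum_x F x = \sum_(i < #|T|) F (enum_val i).
  by rewrite (reindex (@enum_val T T)) //; exact/onW_bij/enum_val_bij.
rewrite /mxform mxE exchange_big /= sumE; apply: eq_bigr => j _.
rewrite !mxE mulr_suml sumE; apply: eq_bigr => i _.
by rewrite !mxE ME.
Qed.

Lemma mxform_id h h' :
  mxform 1%:M (rowfun h) (rowfun h') = \sum_x h x * h' x.
Proof.
rewrite (@mxform_sum _ (fun x y => (x == y)%:R)) => [|i j]; last first.
  by rewrite mxE (inj_eq enum_val_inj).
apply: eq_bigr => x _; rewrite (bigD1 x) //= eqxx mulr1 big1 ?addr0 // => y yx.
by rewrite eq_sym (negPf yx) mulr0 mul0r.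
Qed.

Lemma mxform_adjacency h h' :
  mxform (adjacency_mx R G) (rowfun h) (rowfun h') =
  \sum_x \sum_(y | G x y) h x * h' y.
Proof.
rewrite (@mxform_sum _ (fun x y => (G x y)%:R)) => [|i j]; last by rewrite mxE.
apply: eq_bigr => x _; rewrite [RHS]big_mkcond; apply: eq_bigr => y _.
by case: (G x y); rewrite ?mulr1 // mulr0 mul0r.
Qed.

Lemma mxform_laplacian d h h' : regular G d ->
  mxform (laplacian_mx R G) (rowfun h) (rowfun h') =
  d%:R * (\sum_x h x * h' x) - \sum_x \sum_(y | G x y) h x * h' y.
Proof.
move=> Gd; rewrite -mxform_adjacency -mxform_id /mxform /laplacian_mx.
have -> : degree_mx R G = d%:R *: 1%:M.
  by apply/matrixP => i j; rewrite !mxE Gd mulr_natr.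
by rewrite mulmxBr mulmxBl -scalemxAr -scalemxAl !mxE.
Qed.

Lemma sum_regular d h : regular G d ->
  \sum_x \sum_(y | G x y) h x = d%:R * \sum_x h x.
Proof.
move=> Gd; rewrite mulr_sumr; apply: eq_bigr => x _.
by rewrite sumr_const -(Gd x) /degree cardsE mulr_natl.
Qed.

Lemma sum_adj_swap (F : T -> T -> R) :
  \sum_x \sum_(y | G x y) F x y = \sum_x \sum_(y | G x y) F y x.
Proof.
rewrite (exchange_big_dep predT) //=; apply: eq_bigr => x _.
by apply: eq_bigl => y; rewrite adj_sym.
Qed.

(** The double sum meets each edge in both directions, hence the factor 2. *)
Lemma mxform_laplacian_diff d h : regular G d ->
  2 * mxform (laplacian_mx R G) (rowfun h) (rowfun h) =
  \sum_x \sum_(y | G x y) (h x - h y) ^+ 2.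
Proof.
move=> Gd; rewrite (mxform_laplacian _ _ Gd) -(sum_regular _ Gd).
pose S := \sum_x \sum_(y | G x y) h x * h x.
have S' : S = \sum_x \sum_(y | G x y) h y * h y by exact: sum_adj_swap.
rewrite -/S mulrBr mulr_natl mulr2n {2}S' mulr_sumr -big_split -sumrB /=.
apply: eq_bigr => x _; rewrite mulr_sumr -big_split -sumrB /=.
by apply: eq_bigr => y _; ring.
Qed.

End Forms.

(** * Distance levels around a set *)

Section Levels.
Variables (T : finType) (G : simple_graph T).

Fixpoint nball (S : {set T}) (j : nat) : {set T} :=
  if j is i.+1 then nball S i :|: [set y | [exists x in nball S i, G x y]]
  else S.

(* The distance to [S], truncated at [K]. *)
Definition level K S x : nat := find (fun j => x \in nball S j) (iota 0 K).

Lemma level_le K S x : (level K S x <= K)%N.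
Proof. by rewrite -[leqRHS](size_iota 0) find_size. Qed.

Lemma mem_nball_level K S x :
  (level K S x < K)%N -> x \in nball S (level K S x).
Proof.
move=> lt; have : has (fun j => x \in nball S j) (iota 0 K).
  by rewrite has_find size_iota.
by move=> /(nth_find 0%N); rewrite nth_iota.
Qed.

Lemma level_leP K S x j : (j < K)%N -> x \in nball S j -> (level K S x <= j)%N.
Proof.
move=> jK xj; rewrite leqNgt; apply/negP => lt.
by have := before_find 0%N lt; rewrite nth_iota // xj.
Qed.

Lemma level0 K S x : (0 < K)%N -> (level K S x == 0%N) = (x \in S).
Proof.
move=> K0; apply/eqP/idP => [l0|xS].
  by have := @mem_nball_level K S x; rewrite l0; apply.
by apply/eqP; rewrite -leqn0 level_leP.
Qed.

Lemma level_adj K S x y : G x y -> (level K S y <= (level K S x).+1)%N.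
Proof.
move=> xy; case: (ltnP (level K S x).+1 K) => [lt|ge]; last first.
  exact: leq_trans (level_le _ _ _) ge.
apply: level_leP => //=; rewrite !inE; apply/orP; right.
by apply/existsP; exists x; rewrite mem_nball_level ?xy // ltnW.
Qed.

(** The bound excludes the level [K], shared by all vertices that are too far, which need not have a
    neighbour one level lower. *)
Lemma level_pred K S x l : level K S x = l.+1 -> (l.+1 < K)%N ->
  exists2 y, G x y & level K S y = l.
Proof.
move=> xl lK; have := @mem_nball_level K S x.
rewrite xl /= !inE => /(_ lK) /orP[/level_leP|].
  by move=> /(_ K (ltnW lK)); rewrite xl ltnn.
move=> /existsP[y /andP[yl yx]]; exists y; first by rewrite adj_sym.
apply/eqP; rewrite eqn_leq level_leP // ?(ltnW lK) //.
by have := level_adj K S yx; rewrite xl.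
Qed.

(** Walks may repeat vertices, so they concatenate freely; [dist_walk] shortens them to simple
    paths. *)
Definition walk_le (u v : T) (j : nat) : Prop :=
  exists p, [/\ path G u p, last u p = v & (size p <= j)%N].

Lemma walk_le_cat u v w i j :
  walk_le u v i -> walk_le v w j -> walk_le u w (i + j)%N.
Proof.
move=> [p [up pv pi]] [q [vq qw qj]]; exists (p ++ q).
by rewrite cat_path last_cat up pv size_cat leq_add.
Qed.

Lemma walk_le_sym u v i : walk_le u v i -> walk_le v u i.
Proof.
move=> [p [up pv pi]]; exists (rev (belast u p)).
rewrite -{1}pv rev_path size_rev size_belast; split=> //.
  by rewrite (eq_path (e' := G)) // => x y; rewrite adj_sym.
by case: p {up pi} pv => [|x p] //= _; rewrite rev_cons last_rcons.
Qed.

Lemma nball_walk S j x : x \in nball S j -> exists2 u, u \in S & walk_le u x j.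
Proof.
elim: j x => [|j IH] x /=; first by exists x => //; exists [::].
rewrite !inE => /orP[/IH[u uS [p [up px pj]]]|].
  by exists u => //; exists p; rewrite leqW.
move=> /existsP[y /andP[/IH[u uS uy] yx]]; exists u => //; rewrite -addn1.
by apply: walk_le_cat uy _; exists [:: x]; rewrite /= yx.
Qed.

(** The walk leads from [S] to [x], by at most one step to [y], and on to [S']: its length is at
    most (K - 1) + 1 + (K - 1). *)
Lemma level_sep K S S' x y : (level K S x < K)%N -> (level K S' y < K)%N ->
  (x == y) || G x y ->
  exists u v, [/\ u \in S, v \in S' & walk_le u v (2 * K).-1].
Proof.
move=> xK yK xy.
have [u uS ux] := nball_walk (mem_nball_level xK).
have [v vS /walk_le_sym yv] := nball_walk (mem_nball_level yK).
have xyw : walk_le x y 1.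
  case/orP: xy => [/eqP->|xy]; first by exists [::].
  by exists [:: y]; rewrite /= xy.
exists u, v; split=> //.
have [p [up pv pl]] := walk_le_cat (walk_le_cat ux xyw) yv.
by exists p; split=> //; apply: leq_trans pl _; lia.
Qed.

Lemma dist_walk (R : realType) u v j :
  walk_le u v j -> (dist R G u v <= j%:R%:E)%E.
Proof.
move=> [p [up pv pj]]; case/shortenP: up pv => q uq uniq_q qp qv.
apply: (@le_trans _ _ ((size q)%:R%:E)).
  by apply: ereal_inf_lbound; exists q.
rewrite lee_fin ler_nat (leq_trans _ pj) // uniq_leq_size //.
by case/andP: uniq_q.
Qed.

Lemma edge_dist_walk (R : realType) (e f : {set T}) u v j :
  u \in e -> v \in f -> walk_le u v j -> (edge_dist R G e f <= j%:R%:E)%E.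
Proof.
move=> ue vf /(dist_walk R); apply: le_trans.
rewrite /edge_dist (le_trans (bigmin_le_cond _ _ ue)) //.
exact: bigmin_le_cond.
Qed.

Section LevelFunction.
Variables (R : realType) (K : nat).
Implicit Types (a : nat -> R) (S : {set T}).

Definition level_fun a S : 'rV[R]_#|T| := rowfun (fun x => a (level K S x)).

Lemma level_fun_norm a S : mxform 1%:M (level_fun a S) (level_fun a S) =
  \sum_x a (level K S x) ^+ 2.
Proof. by rewrite mxform_id; apply: eq_bigr => x _; rewrite expr2. Qed.

(** As [a K = 0], each function lives on the levels below [K]. Equal or adjacent vertices of the two
    supports would yield a forbidden walk by [level_sep], so every cross term is zero. *)
Lemma level_fun_orthogonal a (S S' : {set T}) : a K = 0 ->
  (forall u v, u \in S -> v \in S' -> ~ walk_le u v (2 * K).-1) ->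
  [/\ mxform (adjacency_mx R G) (level_fun a S) (level_fun a S') = 0,
      mxform 1%:M (level_fun a S) (level_fun a S') = 0 &
      forall d, regular G d ->
      mxform (laplacian_mx R G) (level_fun a S) (level_fun a S') = 0].
Proof.
move=> aK sep.
have a0 x y : (x == y) || G x y -> a (level K S x) * a (level K S' y) = 0.
  move=> xy; have := level_le K S x; rewrite leq_eqVlt => /orP[/eqP->|xK].
    by rewrite aK mul0r.
  have := level_le K S' y; rewrite leq_eqVlt => /orP[/eqP->|yK].
    by rewrite aK mulr0.
  by have [u [v [uS vS /sep]]] := level_sep xK yK xy; case.
have s0 : \sum_x a (level K S x) * a (level K S' x) = 0.
  by rewrite big1 // => x _; rewrite a0 ?eqxx.
have A0 : \sum_x \sum_(y | G x y) a (level K S x) * a (level K S' y) = 0.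
  by rewrite big1 // => x _; rewrite big1 // => y xy; rewrite a0 ?xy ?orbT.
split; first by rewrite mxform_adjacency.
  by rewrite mxform_id.
by move=> d Gd; rewrite (mxform_laplacian _ _ Gd) A0 s0 mulr0 subr0.
Qed.

End LevelFunction.
End Levels.

Definition alternate (R : pzRingType) (a : nat -> R) i : R := (-1) ^+ i * a i.

Lemma alternate_sqr (R : comPzRingType) (a : nat -> R) i :
  alternate a i ^+ 2 = a i ^+ 2.
Proof. by rewrite exprMn sqrr_sign mul1r. Qed.

Lemma level_fun_norm_alternate (T : finType) (G : simple_graph T)
    (R : realType) K (a : nat -> R) S :
  mxform 1%:M (level_fun G K (alternate a) S) (level_fun G K (alternate a) S) =
  mxform 1%:M (level_fun G K a S) (level_fun G K a S).
Proof.
rewrite !level_fun_norm; apply: eq_bigr => x _; exact: alternate_sqr.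
Qed.

(** * Edges and the Laplacian: geometric test functions *)

Section EdgeCase.
Variables (R : realType) (T : finType) (G : simple_graph T) (d k : nat).
Variables (r : R) (S : {set T}).
Hypotheses (Gd : regular G d) (r0 : 0 < r).
Hypothesis rd : r ^+ 2 = d.-1%:R.
Hypothesis SE : S \in edges G.
Let lev := level G k.+1 S.
Let n i := #|[set x | lev x == i]|.

Definition truncated_geometric i : R := if (i <= k)%N then r ^- i else 0.
Let a := truncated_geometric.

(** For i < k both products equal r^-2i (r + 1)^2 (r - 1)^2 / r^2. At i = k the next value is 0, and
    (r + 1)^2 - (r - 1)^2 = 4r remains. *)
Lemma geometric_step i : (i <= k)%N ->
  (r + 1) ^+ 2 * (a i - a i.+1) ^+ 2
   - (r - 1) ^+ 2 * (alternate a i - alternate a i.+1) ^+ 2 =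
  4 * r * (r ^- k) ^+ 2 *+ (i == k).
Proof.
have rN0 : r != 0 by rewrite gt_eqF.
have -> : alternate a i - alternate a i.+1 = (-1) ^+ i * (a i + a i.+1).
  by rewrite /alternate exprS; ring.
rewrite exprMn sqrr_sign mul1r /a /truncated_geometric => ik; rewrite ik.
case: eqVneq => [->|iNk]; first by rewrite ltnn mulr1n; move: (r ^- k) => x; ring.
have -> : (i < k)%N by lia.
rewrite mulr0n (exprS r i) invfM; set x := r ^- i.
by field.
Qed.

Lemma geometric_adj x y : G x y ->
  (r + 1) ^+ 2 * (a (lev x) - a (lev y)) ^+ 2
   - (r - 1) ^+ 2 * (alternate a (lev x) - alternate a (lev y)) ^+ 2 =
  4 * r * (r ^- k) ^+ 2 *+ ((lev x == k) && (lev y == k.+1))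
  + 4 * r * (r ^- k) ^+ 2 *+ ((lev y == k) && (lev x == k.+1)).
Proof.
move=> xy; have := level_adj k.+1 S xy.
rewrite adj_sym in xy; have := level_adj k.+1 S xy.
have := level_le G k.+1 S x; have := level_le G k.+1 S y; rewrite -!/(lev _).
move: (lev x) (lev y) => {xy} {}x {}y xk yk xy yx.
have step i j : j = i.+1 -> (i <= k)%N -> (r + 1) ^+ 2 * (a i - a j) ^+ 2
   - (r - 1) ^+ 2 * (alternate a i - alternate a j) ^+ 2 =
   4 * r * (r ^- k) ^+ 2 *+ ((i == k) && (j == k.+1))
   + 4 * r * (r ^- k) ^+ 2 *+ ((j == k) && (i == k.+1)).
  move=> -> ik; rewrite geometric_step //.
  have -> : (i.+1 == k) && (i == k.+1) = false by lia.
  by rewrite addr0 eqSS andbb.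
have [e|[e|e]] : y = x \/ y = x.+1 \/ x = y.+1 by lia.
- have -> : (x == k) && (y == k.+1) = false by lia.
  have -> : (y == k) && (x == k.+1) = false by lia.
  by rewrite e !subrr expr0n /= !mulr0n !mulr0 subrr addr0.
- by apply: step => //; lia.
- rewrite [RHS]addrC -step //; last by lia.
  by rewrite -(opprB (a y)) -(opprB (alternate a y)) !sqrrN.
Qed.

(** Here it matters that [S] is an edge: each of its endpoints has the other one as a neighbour on
    level 0. *)
Lemma edge_level_down x : (lev x <= k)%N ->
  exists2 y, G x y & (lev y <= lev x)%N.
Proof.
case E: (lev x) => [|i] ik.
  have: x \in S by rewrite -(@level0 _ G k.+1) // -/(lev x) E.
  case/imsetP: SE => -[u v] /=; rewrite inE /= => uv SE'.
  have inS z : z \in S -> (lev z <= 0)%N by rewrite leqn0 [_ == _]level0.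
  have uS : u \in S by rewrite SE' set21.
  have vS : v \in S by rewrite SE' set22.
  rewrite {1}SE' => /set2P[] ->; first by exists v => //; exact: inS.
  by exists u; [rewrite adj_sym | exact: inS].
have [y xy yi] := level_pred E ik; exists y => //.
by rewrite /lev yi.
Qed.

Lemma edge_level_up x : (lev x <= k)%N ->
  (#|[set y | G x y & lev y == (lev x).+1]| <= d.-1)%N.
Proof.
move=> /edge_level_down[z xz zx]; rewrite -(Gd x) /degree.
rewrite (cardsD1 z [set y | G x y]) inE xz add1n /=.
apply: subset_leq_card; apply/fintype.subsetP => y; rewrite !inE.
case/andP => -> /eqP yx; rewrite andbT; apply: contraTneq zx => <-.
by rewrite yx ltnn.
Qed.

(** Double counting of the edges between the two levels: at least one goes down from each upper
    vertex, at most d - 1 go up from each lower one. *)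
Lemma edge_level_card_step i : (i < k)%N -> (n i.+1 <= d.-1 * n i)%N.
Proof.
move=> ik; rewrite /n -sum1_card.
pose P x y := [&& G x y, lev x == i.+1 & lev y == i].
apply: (@leq_trans (\sum_x \sum_(y | P x y) 1)%N).
  rewrite big_mkcond leq_sum // => x _; rewrite inE.
  case: ifP => // /eqP xi; have [|y xy yi] := @level_pred _ G k.+1 S x i xi.
    by lia.
  by rewrite (bigD1 y) // /P xy xi /lev yi !eqxx.
rewrite (exchange_big_dep (fun y => lev y == i)) /=; last first.
  by move=> x y _ /and3P[].
rewrite mulnC -[in leqRHS]sum1dep_card big_distrl /=; apply: leq_sum => y /eqP yi.
rewrite mul1n sum1dep_card.
rewrite (leq_trans _ (edge_level_up (x := y) _)) ?yi ?(ltnW ik) //.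
apply/subset_leq_card/fintype.subsetP => x; rewrite !inE => /and3P[].
by rewrite adj_sym => -> ->.
Qed.

(** As r^2 = d - 1, the level masses r^-2i n_i do not increase up to level k, so each of the k + 1
    levels carries at least the mass of the last. *)
Lemma edge_norm_ge : k.+1%:R * ((r ^- k) ^+ 2 * (n k)%:R) <=
  mxform 1%:M (level_fun G k.+1 a S) (level_fun G k.+1 a S).
Proof.
have rN0 : r != 0 by rewrite gt_eqF.
have mono i : (i <= k)%N -> (r ^- k) ^+ 2 * (n k)%:R <= (r ^- i) ^+ 2 * (n i)%:R.
  move=> ik; have -> : i = (k - (k - i))%N by lia.
  elim: (k - i)%N (leq_subr i k) => [|j IH] jk; first by rewrite subn0.
  apply: le_trans (IH (ltnW jk)) _; have -> : (k - j)%N = (k - j.+1).+1 by lia.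
  have lt : (k - j.+1 < k)%N by lia.
  have := edge_level_card_step lt; rewrite -(ler_nat R) natrM -rd.
  move: (k - j.+1)%N => m le.
  rewrite (exprS r m) invfM exprMn -mulrA mulrCA ler_wpM2l ?sqr_ge0 //.
  by rewrite exprVn ler_pdivrMl ?exprn_gt0.
rewrite level_fun_norm mulr_natl.
have -> : \sum_x a (level G k.+1 S x) ^+ 2 =
    \sum_(i < k.+1) (r ^- i) ^+ 2 * (n i)%:R.
  under [RHS]eq_bigr => i _.
    rewrite /n -sum1dep_card natr_sum mulr_sumr big_mkcond /=.
    under eq_bigr => x _ do rewrite mulr1.
    over.
  rewrite exchange_big; apply: eq_bigr => x _.
  rewrite -/(lev x) /a /truncated_geometric.
  rewrite -big_mkcond; case: leqP => xk.
    by rewrite (big_pred1 (Ordinal (xk : (lev x < k.+1)%N))).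
  rewrite expr0n big1 // => i /eqP xi.
  by have := ltn_ord i; rewrite -xi ltnNge xk.
rewrite -[X in _ *+ X]card_ord -sumr_const.
by apply: ler_sum => i _; apply: mono; rewrite -ltnS.
Qed.

Lemma edge_tradeoff :
  (r + 1) ^+ 2 * mxform (laplacian_mx R G)
     (level_fun G k.+1 a S) (level_fun G k.+1 a S) <=
  (r - 1) ^+ 2 * mxform (laplacian_mx R G)
     (level_fun G k.+1 (alternate a) S) (level_fun G k.+1 (alternate a) S)
  + 4 * r ^+ 3 / k.+1%:R *
    mxform 1%:M (level_fun G k.+1 a S) (level_fun G k.+1 a S).
Proof.
set Lf := mxform (laplacian_mx _ _) _ _; set Lg := mxform (laplacian_mx _ _) _ _.
set N := mxform 1%:M _ _.
pose c := 4 * r * (r ^- k) ^+ 2; have c0 : 0 <= c.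
  by rewrite mulr_ge0 ?sqr_ge0 // mulr_ge0 // ltW.
(* [B] takes each edge leaving level k in its outward direction only; both directions give [B + B],
   matching the factor 2 of [mxform_laplacian_diff]. *)
pose B := \sum_x \sum_(y | G x y) c *+ ((lev x == k) && (lev y == k.+1)).
have E : (r + 1) ^+ 2 * (2 * Lf) - (r - 1) ^+ 2 * (2 * Lg) = B + B.
  rewrite {2}/B sum_adj_swap /B -big_split /=.
  rewrite /Lf /Lg !(mxform_laplacian_diff _ Gd) !mulr_sumr -sumrB.
  apply: eq_bigr => x _; rewrite !mulr_sumr -sumrB -big_split /=.
  by apply: eq_bigr => y; exact: geometric_adj.
(* At most d - 1 = r^2 edges go up from each vertex of level k. *)
have Bn : B <= c * (r ^+ 2 * (n k)%:R).
  rewrite /n -sum1dep_card natr_sum !mulr_sumr [leRHS]big_mkcond ler_sum // => x _.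
  case: eqVneq => xk /=; last by rewrite big1.
  under eq_bigr => y _ do rewrite mulrb.
  rewrite mulr1 -big_mkcondr /= sumr_const -mulr_natr ler_wpM2l // rd ler_nat.
  apply: leq_trans (edge_level_up (x := x) _); rewrite ?xk //.
  by apply/subset_leq_card/fintype.subsetP => y; rewrite !inE.
have Nn := edge_norm_ge; rewrite -/N in Nn.
have kR : 0 < k.+1%:R :> R by rewrite ltr0n.
suff le : c * (r ^+ 2 * (n k)%:R) <= 4 * r ^+ 3 / k.+1%:R * N.
  have half (u v x y b b' : R) :
      u * (2 * x) - v * (2 * y) = b + b -> b <= b' -> u * x <= v * y + b'.
    by lra.
  exact: half E (le_trans Bn le).
have -> : c * (r ^+ 2 * (n k)%:R) =
    4 * r ^+ 3 / k.+1%:R * (k.+1%:R * ((r ^- k) ^+ 2 * (n k)%:R)).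
  rewrite /c; move: (r ^- k) => u; field; exact: lt0r_neq0.
by rewrite ler_wpM2l // divr_ge0 // mulr_ge0 // exprn_ge0 // ltW.
Qed.

End EdgeCase.

(** * Vertices and the adjacency matrix: sine test functions *)

Section VertexCase.
Variables (R : realType) (T : finType) (G : simple_graph T) (d k : nat).
Variables (r : R) (v : T).
Hypotheses (d5 : (5 <= d)%N) (k0 : (0 < k)%N) (Gd : regular G d) (r0 : 0 < r).
Hypothesis rd : r ^+ 2 = d.-1%:R.
Let lev := level G (2 * k) [set v].
Let theta : R := pi / (2 * k%:R).

(** The angle [theta] makes the wave vanish at level 0 and at the truncation level 2k. *)
Definition sine_wave i : R := r ^- i * sin (theta * i%:R).
Let s i : R := sin (theta * i%:R).
Let a := sine_wave.

Lemma theta_gt0 : 0 < theta.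
Proof. by rewrite divr_gt0 ?pi_gt0 // mulr_gt0 // ltr0n. Qed.

Lemma theta_pi : theta * (2 * k)%:R = pi.
Proof. by rewrite natrM mulfVK // mulf_neq0 // pnatr_eq0 -lt0n. Qed.

Lemma sine_ge0 i : (i <= 2 * k)%N -> 0 <= s i.
Proof.
move=> ik; apply: sin_ge0_pi; rewrite mulr_ge0 ?(ltW theta_gt0) //=.
by rewrite -theta_pi ler_pM2l ?theta_gt0 // ler_nat.
Qed.

Lemma sine_wave_ge0 i : (i <= 2 * k)%N -> 0 <= a i.
Proof.
by move=> ik; rewrite mulr_ge0 ?sine_ge0 // invr_ge0 exprn_ge0 // ltW.
Qed.

Lemma sine_wave0 : a 0 = 0.
Proof. by rewrite /a /sine_wave mulr0 sin0 mulr0. Qed.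

Lemma sine_wave_end : a (2 * k) = 0.
Proof. by rewrite /a /sine_wave theta_pi sinpi mulr0. Qed.

Lemma sine_rec i : s i.+2 + s i = 2 * cos theta * s i.+1.
Proof.
have -> : s i.+2 = sin (theta * i.+1%:R + theta).
  by congr sin; rewrite -[X in _ + X]mulr1 -mulrDr -natr1.
have -> : s i = sin (theta * i.+1%:R - theta).
  by congr sin; rewrite -natr1; ring.
by rewrite sinD sinB /s; ring.
Qed.

(** Concavity of the sine on [0, pi], read off from the recurrence. *)
Lemma sine_double i : (i.+2 <= 2 * k)%N -> s i.+2 <= 2 * s i.+1 - s i.
Proof.
move=> ik; have := sine_rec i; have := sine_ge0 (ltnW ik).
move=> si e; have : cos theta * s i.+1 <= s i.+1 by rewrite ler_piMl ?cos_le1.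
by lra.
Qed.

Lemma sine_wave_succ i : r * a i.+1 = r ^- i * s i.+1.
Proof.
by rewrite /a /sine_wave exprS invfM -mulrA mulVKf // gt_eqF.
Qed.

(** Inside a level the alternating signs agree, giving (r + 2) - (r - 2) = 4; between levels they
    differ, giving (r + 2) + (r - 2) = 2r. *)
Let weight x y : R :=
  if lev y == lev x then 4 * a (lev y) else 2 * r * a (lev y).

(** Among the neighbours other than [p], those one level up weigh least. Concavity settles the same
    level; the lower level also needs r^2 >= 4, from [d >= 5]. *)
Lemma weight_ge x p y i : G x p -> lev x = i.+1 -> (i.+2 <= 2 * k)%N ->
  lev p = i -> G x y -> y != p -> 2 * r * a i.+2 <= weight x y.
Proof.
move=> xp xi ik pi xy yp; rewrite /weight xi.
have rN0 : r != 0 by rewrite gt_eqF.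
have r4 : 4 <= r ^+ 2 by rewrite rd ler_nat; lia.
have yi1 := level_adj (2 * k) [set v] xy.
have iy1 : G y x by rewrite adj_sym.
have {}iy1 := level_adj (2 * k) [set v] iy1.
rewrite -!/(lev _) xi in yi1 iy1.
have sE : 2 * r * a i.+2 = r ^- i.+1 * (2 * s i.+2).
  by rewrite -mulrA sine_wave_succ mulrCA.
have [e|[e|e]] : lev y = i \/ lev y = i.+1 \/ lev y = i.+2 by lia.
- rewrite e ifN ?neq_ltn ?ltnSn //.
  (* Level 0 contains only [v], so a second lower neighbour forces [x] to level 2 or higher. *)
  case: i e xi ik pi sE yi1 iy1 => [|i] e xi ik pi sE yi1 iy1.
    have inv z : lev z = 0 -> z = v.
      by move/eqP; rewrite level0 ?muln_gt0 ?k0 // => /set1P.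
    by rewrite (inv _ e) (inv _ pi) eqxx in yp.
  rewrite sE; have -> : 2 * r * a i.+1 = r ^- i.+2 * (2 * r ^+ 2 * s i.+1).
    rewrite -mulrA sine_wave_succ (exprS r i.+1) (exprS r i) !invfM.
    by move: (r ^- i) => w; field.
  rewrite ler_wpM2l ?invr_ge0 ?exprn_ge0 ?(ltW r0) //.
  (* Concavity used twice bounds [s i.+3] by [3 * s i.+1]. *)
  have h1 := sine_double ik; have h2 := sine_double (ltnW ik).
  have h3 := sine_ge0 (ltnW (ltnW ik)); have h4 : 0 <= s i by apply: sine_ge0; lia.
  have : 4 * s i.+1 <= r ^+ 2 * s i.+1 by rewrite ler_wpM2r.
  by lra.
- rewrite e eqxx sE; have -> : 4 * a i.+1 = r ^- i.+1 * (4 * s i.+1).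
    by rewrite /a /sine_wave mulrCA.
  rewrite ler_wpM2l ?invr_ge0 ?exprn_ge0 ?(ltW r0) //.
  have h1 := sine_double ik; have h4 : 0 <= s i by apply: sine_ge0; lia.
  by lra.
- by rewrite e ifN // neq_ltn ltnSn orbT.
Qed.

(** One lower neighbour gives 2r a_i and each of the other d - 1 = r^2 at least 2r a_(i+2);
    [sine_rec] sums these to 4 r^2 cos(theta) a_(i+1). At levels 0 and 2k both sides vanish. *)
Lemma weight_sum_ge x :
  4 * r ^+ 2 * cos theta * a (lev x) ^+ 2 <=
  \sum_(y | G x y) a (lev x) * weight x y.
Proof.
have rN0 : r != 0 by rewrite gt_eqF.
have zero : a (lev x) = 0 -> 4 * r ^+ 2 * cos theta * a (lev x) ^+ 2 <=
    \sum_(y | G x y) a (lev x) * weight x y.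
  by move=> ->; rewrite expr0n mulr0 big1 // => y _; rewrite mul0r.
have := level_le G (2 * k) [set v] x; rewrite leq_eqVlt => /orP[/eqP e|].
  by apply: zero; rewrite /lev e sine_wave_end.
case E: (level _ _ _ x) => [|i] ik; first by apply: zero; rewrite /lev E sine_wave0.
have [p xp pi] := level_pred E ik.
rewrite -mulr_sumr expr2 mulrCA ler_wpM2l ?sine_wave_ge0 ?level_le //.
rewrite /lev E -/lev (bigD1 p) //=.
have card : #|[pred y | G x y & y != p]| = d.-1.
  rewrite -(Gd x) /degree (cardsD1 p [set y | G x y]) inE xp add1n /=.
  by apply: eq_card => y; rewrite !inE andbC.
have : \sum_(y | G x y && (y != p)) 2 * r * a i.+2 <=
    \sum_(y | G x y && (y != p)) weight x y.
  by apply: ler_sum => y /andP[xy yp]; exact: weight_ge xp E ik pi xy yp.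
rewrite sumr_const card -[_ *+ d.-1]mulr_natr -rd => le.
have -> : weight x p = 2 * r * a i.
  by rewrite /weight /lev E pi ifN // neq_ltn ltnSn.
apply: le_trans (lerD (lexx _) le); rewrite le_eqVlt; apply: predU1l.
have := sine_rec i; rewrite /a /sine_wave -!/(s _) => e.
rewrite !(exprS r) !invfM.
have -> : s i.+2 = 2 * cos theta * s i.+1 - s i by rewrite -e addrK.
move: (r ^- i) => w.
by field.
Qed.

(** The alternating function serves the low end of the spectrum, and the cosine term enters as a
    negative constant [c] of [spectrum_tradeoff]. *)
Lemma vertex_tradeoff :
  (r - 2) * mxform (adjacency_mx R G)
    (level_fun G (2 * k) (alternate a) [set v])
    (level_fun G (2 * k) (alternate a) [set v]) <=
  (r + 2) * mxform (adjacency_mx R G)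
    (level_fun G (2 * k) a [set v]) (level_fun G (2 * k) a [set v])
  + (- (4 * r ^+ 2 * cos theta)) * mxform 1%:M
    (level_fun G (2 * k) (alternate a) [set v])
    (level_fun G (2 * k) (alternate a) [set v]).
Proof.
rewrite level_fun_norm_alternate level_fun_norm !mxform_adjacency.
rewrite mulNr lerBrDl -lerBrDr !mulr_sumr -sumrB ler_sum // => x _.
rewrite -/(lev x) (le_trans (weight_sum_ge x)) // !mulr_sumr -sumrB.
rewrite ler_sum // => y xy; rewrite -/(lev y) /weight.
have yx := level_adj (2 * k) [set v] xy.
have xy' : G y x by rewrite adj_sym.
have {}xy' := level_adj (2 * k) [set v] xy'.
rewrite -!/(lev _) in yx xy'.
have -> i j : alternate a i * alternate a j = (-1) ^+ (i + j) * (a i * a j).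
  by rewrite exprD /alternate mulrACA.
case: eqVneq => [->|ne].
  by rewrite addnn -signr_odd odd_double mul1r le_eqVlt; apply: predU1l; ring.
have : odd (lev x + lev y) by rewrite oddD; lia.
by rewrite -signr_odd => ->; rewrite expr1; rewrite le_eqVlt; apply: predU1l; ring.
Qed.

(** The wave vanishes at [v] itself, so positivity comes from a neighbour on level 1, where
    sin(theta) > 0. *)
Lemma vertex_norm_gt0 : 0 < mxform 1%:M
  (level_fun G (2 * k) a [set v]) (level_fun G (2 * k) a [set v]).
Proof.
have [x] : exists x, x \in [set y | G v y].
  by apply/set0Pn; rewrite -card_gt0 [#|_|]Gd; lia.
rewrite inE => vx; have := level_adj (2 * k) [set v] vx.
have lev0 z : (lev z == 0%N) = (z == v).
  by rewrite level0 ?muln_gt0 // finset.in_set1.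
have /eqP lv : lev v == 0%N by rewrite lev0.
rewrite -!/(lev _) lv => x1; have {}x1 : lev x = 1.
  have : lev x != 0%N
    by rewrite lev0; apply: contraTneq vx => ->; rewrite adj_irrefl.
  by lia.
rewrite level_fun_norm (bigD1 x) //= ltr_pwDl ?sumr_ge0 // => [|y _].
  rewrite -/(lev x) x1 exprn_gt0 // mulr_gt0 ?invr_gt0 ?exprn_gt0 //.
  apply: sin_gt0_pi; rewrite mulr1 theta_gt0 /= -theta_pi.
  by rewrite ltr_pMr ?theta_gt0 // ltr1n; lia.
exact: sqr_ge0.
Qed.

End VertexCase.

(** * Choice of indices and test functions for both parts *)

Theorem theorem1p5 (R : realType) (s k : nat) (hs : (0 < s)%N) (hk : (0 < k)%N) :
  (forall (d n : nat) (T : finType) (G : simple_graph T),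
     (3 <= d)%N -> #|T| = n -> regular G d ->
     (exists M : {set {set T}},
        [/\ M \subset edges G, #|M| = (4 * s - 2)%N &
            forall e f : {set T}, e \in M -> f \in M -> e != f ->
              ((2 * k + 2)%:R%:E <= edge_dist R G e f)%E]) ->
     (d%:R + 2 * Num.sqrt (d%:R - 1)) * lambda R G (s + 1) <=
     (d%:R - 2 * Num.sqrt (d%:R - 1)) * lambda R G (n - s + 1)
       + 4 * (d%:R - 1) `^ (3 / 2) / (k%:R + 1)) /\
  (forall (d n : nat) (T : finType) (G : simple_graph T),
     (5 <= d)%N -> #|T| = n -> regular G d ->
     (exists U : {set T},
        #|U| = (2 * s + 1)%N /\
        forall u v : T, u \in U -> v \in U -> u != v ->
          ((4 * k)%:R%:E <= dist R G u v)%E) ->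
     (Num.sqrt (d%:R - 1) + 2) * mu R G (s + 1)
       - (Num.sqrt (d%:R - 1) - 2) * mu R G (n - s + 1) >=
     4 * (d%:R - 1) * cos (pi / (2 * k%:R))).
Proof.
split=> d n T G hd nT Gd.
- move=> [M [ME cM sepM]].
  set r := Num.sqrt _.
  have d1 : d%:R - 1 = d.-1%:R :> R by rewrite -subn1 natrB //; lia.
  have rd : r ^+ 2 = d.-1%:R by rewrite sqr_sqrtr d1.
  rewrite -rd in d1.
  have r0 : 0 < r by rewrite sqrtr_gt0 subr_gt0 ltr1n; lia.
  have -> : d%:R + 2 * r = (r + 1) ^+ 2.
    by rewrite -[d%:R](subrK 1) d1; ring.
  have -> : d%:R - 2 * r = (r - 1) ^+ 2.
    by rewrite -[d%:R](subrK 1) d1; ring.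
  have -> : (d%:R - 1) `^ (3 / 2) = r ^+ 3 :> R.
    have d0 : 0 <= d%:R - 1 :> R by rewrite d1 sqr_ge0.
    by rewrite mulrC powRrM powR12_sqrt // powR_mulrn // ltW.
  rewrite natr1 /lambda !addn1 /=.
  (* In 0-based positions this is i = s from the bottom and j = s - 1 from the top, and i + j = 2s -
     1 < 4s - 2. *)
  have -> : (n - s)%N = (#|T| - s.-1.+1)%N by rewrite nT prednK.
  have walks e f : e \in M -> f \in M -> e != f ->
      forall u v, u \in e -> v \in f -> ~ walk_le G u v (2 * k.+1).-1.
    move=> eM fM ef u v ue vf /(edge_dist_walk R ue vf).
    move/(le_trans (sepM e f eM fM ef)).
    by rewrite lee_fin ler_nat; lia.
  pose a := truncated_geometric k r.
  have aK : a k.+1 = 0 by rewrite /a /truncated_geometric ltnn.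
  have bK : alternate a k.+1 = 0 by rewrite /alternate aK mulr0.
  apply: (spectrum_tradeoff (U := M) (f := level_fun G k.+1 a)
    (g := level_fun G k.+1 (alternate a))).
  + exact: laplacian_mx_sym.
  + exact: sqr_ge0.
  + exact: sqr_ge0.
  + by rewrite cM; lia.
  + move=> e /(fintype.subsetP ME); case/imsetP=> -[u v]; rewrite inE /= => uv ->.
    rewrite level_fun_norm (bigD1 u) //= ltr_pwDl ?sumr_ge0 // => [|y _].
      have /eqP -> : level G k.+1 [set u; v] u == 0%N by rewrite level0 ?set21.
      by rewrite /a /truncated_geometric expr0 invr1 expr1n ltr01.
    exact: sqr_ge0.
  + by move=> e _; exact: level_fun_norm_alternate.
  + move=> e f eM fM ef.
    by have [_ ? /(_ _ Gd)] := level_fun_orthogonal aK (walks e f eM fM ef).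
  + move=> e f eM fM ef.
    by have [_ ? /(_ _ Gd)] := level_fun_orthogonal bK (walks e f eM fM ef).
  + by move=> e eM; apply: edge_tradeoff => //; exact: (fintype.subsetP ME).
- move=> [U [cU sepU]].
  set r := Num.sqrt _.
  have d1 : d%:R - 1 = d.-1%:R :> R by rewrite -subn1 natrB //; lia.
  have rd : r ^+ 2 = d.-1%:R by rewrite sqr_sqrtr d1.
  rewrite -rd in d1.
  have r0 : 0 < r by rewrite sqrtr_gt0 subr_gt0 ltr1n; lia.
  (* From [d >= 5]; it makes the weight [r - 2] nonnegative. *)
  have r2 : 2 <= r.
    by rewrite -(ler_pXn2r (n := 2)) ?nnegrE ?(ltW r0) // rd -natrX ler_nat; lia.
  have Un : (2 * s + 1 <= n)%N by rewrite -cU -nT max_card.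
  have sz := size_spectrum (adjacency_mx_sym R G).
  (* Reversal exchanges the ends: [mu (n - s + 1)] sits at i = s - 1 from the bottom and
     [mu (s + 1)] at j = s from the top. [Un] keeps the positions in range. *)
  rewrite /mu !addn1 /= !nth_rev ?sz ?nT; try lia.
  have -> : (#|T| - (n - s).+1)%N = s.-1 by rewrite nT; lia.
  rewrite lerBrDl -lerBrDr d1.
  have walks (v w : T) : v \in U -> w \in U -> v != w ->
      forall x y, x \in [set v] -> y \in [set w] ->
      ~ walk_le G x y (2 * (2 * k)).-1.
    move=> vU wU vw x y /set1P-> /set1P-> /(dist_walk R).
    move/(le_trans (sepU v w vU wU vw)).
    by rewrite lee_fin ler_nat; lia.
  pose a := sine_wave k r.
  have aK : a (2 * k)%N = 0 by exact: sine_wave_end.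
  have bK : alternate a (2 * k) = 0 by rewrite /alternate aK mulr0.
  apply: (spectrum_tradeoff (U := U)
    (f := fun v => level_fun G (2 * k) (alternate a) [set v])
    (g := fun v => level_fun G (2 * k) a [set v])).
  + exact: adjacency_mx_sym.
  + by rewrite subr_ge0.
  + by rewrite addr_ge0 // ltW.
  + by rewrite cU; lia.
  + by move=> v _; rewrite level_fun_norm_alternate; exact: vertex_norm_gt0 Gd r0.
  + by move=> v _; rewrite level_fun_norm_alternate.
  + move=> v w vU wU vw.
    by have [] := level_fun_orthogonal bK (walks v w vU wU vw).
  + move=> v w vU wU vw.
    by have [] := level_fun_orthogonal aK (walks v w vU wU vw).
  + by move=> v _; exact: vertex_tradeoff Gd r0 rd.
Qed.
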